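(* For every base network $f$, every Bayesian neural network (BNN) defined with respect to $f$ can be expressed as an epistemic neural network (ENN) defined with respect to $f$. However, there exist a base network $f$ and an ENN defined with respect to $f$ that cannot be expressed as a BNN defined with respect to $f$.
   Context: Base network: a parameterized function class $f$ which, given a parameter vector $\theta$ (a finite-dimensional real vector, ranging over the parameter space of $f$) and an input $x$, produces a vector-valued output $f_\theta(x)$. BNN: a pair $(f,p)$ consisting of a base network $f$ and a parameterized sampling distribution $p$; for each parameter $\nu$, $p_\nu$ is a probability distribution over the parameters $\theta$ of $f$. A sample $\hat\theta\sim p_\nu$ generates a random function $f_{\hat\theta}$. The BNN $(f,p)$ is said to be defined with respect to its base network $f$. ENN: a pair $(f',P_Z)$ consisting of a parameterized function class $f'$ and a reference probability distribution $P_Z$; given parameters $\theta'$, an input $x$ and an epistemic index $z$ in the support of $P_Z$, the output is a vector $f'_{\theta'}(x,z)$. The ENN $(f',P_Z)$ is said to be defined with respect to a base network $f$ if, for every parameter $\theta$ of $f$, there exist ENN parameters $\theta'$ such that $f'_{\theta'}(\cdot,z)=f_\theta$ for $P_Z$-almost every $z$. All maps are understood to be measurable, so that outputs at random parameters or random indices are random vectors. Consider, for a BNN $(f,p)$, a BNN parameter $\nu$, an ENN $(f',P_Z)$, an ENN parameter $\theta'$, an integer $\tau\ge 1$ and inputs $x_1,\dots,x_\tau$, the equality in distribution $$(\star)\qquad (f_{\hat\theta}(x_1),\dots,f_{\hat\theta}(x_\tau)) \stackrel{d}{=} (f'_{\theta'}(x_1,z),\dots,f'_{\theta'}(x_\tau,z)),\qquad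 \hat\theta\sim p_\nu,\ z\sim P_Z .$$ A BNN $(f,p)$ is expressed as an ENN $(f',P_Z)$ if for all $\nu$, $\tau$ and inputs $x_1,\dots,x_\tau$ there exists $\theta'$ such that $(\star)$ holds. An ENN $(f',P_Z)$ is expressed as a BNN $(f,p)$ if for all $\theta'$, $\tau$ and inputs $x_1,\dots,x_\tau$ there exists $\nu$ such that $(\star)$ holds. *)

(* Defs.v *)
From HB Require Import structures.
From mathcomp Require Import all_boot all_order all_algebra.
From mathcomp Require Import all_classical all_reals all_analysis.

Set Implicit Arguments.
Unset Strict Implicit.
Unset Printing Implicit Defensive.

Local Open Scope classical_set_scope.
Local Open Scope ring_scope.

(* Vectors of R^n are tuples [n.-tuple R], which carry the product of the Borel
   sigma-algebras, i.e. the Borel sigma-algebra of R^n. *)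

(* A function class is a total function of which only the values at parameters
   in the parameter space matter.  The input type carries no sigma-algebra:
   measurability is in the random argument, at each fixed input. *)
Record base_network (R : realType) := BaseNetwork {
  bn_input : Type;
  bn_out : nat;
  bn_dim : nat;
  bn_params : set (bn_dim.-tuple R);
  bn_params_nonempty : bn_params !=set0;
  bn_params_measurable : measurable bn_params;
  bn_fun : bn_dim.-tuple R -> bn_input -> bn_out.-tuple R;
  bn_fun_measurable : forall x, measurable_fun bn_params (bn_fun ^~ x)
}.
Arguments bn_params {R} b.
Arguments bn_params_measurable {R} b.
Arguments bn_fun {R} b.

(* The sampling parameters range over an arbitrary type.  A distribution over
   the parameter space of [f] is a Borel probability on R^n giving it mass 1. *)
Record bnn (R : realType) (f : base_network R) := BNN {
  bnn_param : Type;
  bnn_dist : bnn_param -> probability ((bn_dim f).-tuple R) R;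
  bnn_dist_params : forall nu, bnn_dist nu (bn_params f) = 1%E
}.

(* [enn_index] stands for the support of the reference distribution: the index
   space is any measurable space carrying [enn_ref], so no topology is needed. *)
Record enn (R : realType) (X : Type) (k : nat) := ENN {
  enn_dim : nat;
  enn_params : set (enn_dim.-tuple R);
  enn_display : measure_display;
  enn_index : measurableType enn_display;
  enn_ref : probability enn_index R;
  enn_fun : enn_dim.-tuple R -> X -> enn_index -> k.-tuple R;
  enn_fun_measurable : forall theta x, enn_params theta ->
    measurable_fun [set: enn_index] (enn_fun theta x)
}.
Arguments enn_params {R X k} e.
Arguments enn_fun {R X k} e.

Definition enn_wrt (R : realType) (f : base_network R)
    (E : enn R (bn_input f) (bn_out f)) : Prop :=
  forall theta, bn_params f theta ->
    exists2 theta', enn_params E theta' &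
      \forall z \ae enn_ref E, enn_fun E theta' ^~ z = bn_fun f theta.
Arguments enn_wrt {R} f E.

(* The restriction to the parameter space only discards a null set; it makes
   the joint law independent of the values of [bn_fun] outside that space. *)
Definition bnn_law (R : realType) (f : base_network R) (B : bnn f)
    (nu : bnn_param B) (tau : nat) (xs : tau.-tuple (bn_input f)) :
    set (tau.-tuple ((bn_out f).-tuple R)) -> \bar R :=
  pushforward (mrestr (bnn_dist nu) (bn_params_measurable f))
    (fun theta => map_tuple (bn_fun f theta) xs).

Definition enn_law (R : realType) (X : Type) (k : nat) (E : enn R X k)
    (theta' : (enn_dim E).-tuple R) (tau : nat) (xs : tau.-tuple X) :
    set (tau.-tuple (k.-tuple R)) -> \bar R :=
  pushforward (enn_ref E)
    (fun z => map_tuple (fun x => enn_fun E theta' x z) xs).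

Definition same_law (R : realType) (f : base_network R) (B : bnn f)
    (nu : bnn_param B) (E : enn R (bn_input f) (bn_out f))
    (theta' : (enn_dim E).-tuple R)
    (tau : nat) (xs : tau.-tuple (bn_input f)) : Prop :=
  forall A : set (tau.-tuple ((bn_out f).-tuple R)), measurable A ->
    bnn_law nu xs A = enn_law theta' xs A.

Definition bnn_expressed_as_enn (R : realType) (f : base_network R)
    (B : bnn f) (E : enn R (bn_input f) (bn_out f)) : Prop :=
  forall (nu : bnn_param B) (tau : nat) (xs : tau.-tuple (bn_input f)),
    (1 <= tau)%N ->
    exists2 theta', enn_params E theta' & same_law nu theta' xs.

Definition enn_expressed_as_bnn (R : realType) (f : base_network R)
    (E : enn R (bn_input f) (bn_out f)) (B : bnn f) : Prop :=
  forall theta' (tau : nat) (xs : tau.-tuple (bn_input f)),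
    enn_params E theta' -> (1 <= tau)%N ->
    exists nu : bnn_param B, same_law nu theta' xs.

(* Main.v *)
(* Every Borel probability on R^n is the image of the uniform law on [0, 1]
   under a measurable map, and this map can be described by countably many bits,
   hence by one real number.  Indeed R^n embeds measurably in R (list the bits
   [q < x_i], for q rational, in base 3), with a measurable left inverse; the
   image law on R is reached from the uniform law by its quantile function,
   which only depends on the truth values of [a < F(q)] for a and q rational,
   F being the distribution function.  So a single ENN, with uniform index and
   one real parameter, reproduces every sampling distribution.  Dirac laws give
   back the base network.
   For the second part, no BNN over the zero network expresses an ENN that outputs 1. *)
Require Import Defs.
From HB Require Import structures.
From mathcomp Require Import all_boot all_order all_algebra.
From mathcomp Require Import all_classical all_reals all_analysis.
From mathcomp Require Import measurable_realfun lra ring.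

Set Implicit Arguments.
Unset Strict Implicit.
Unset Printing Implicit Defensive.

Import Order.TTheory GRing.Theory Num.Theory.
Import numFieldNormedType.Exports.

Local Open Scope classical_set_scope.
Local Open Scope ring_scope.

(** * Coding bit sequences by reals in base 3 *)

Definition ternary_term (R : realType) (b : nat -> bool) (k : nat) : R :=
  if b k then 2 / 3 ^+ k.+1 else 0.

(** With digits 0 and 2 only, the values form the Cantor set, where such expansions are unique. *)
Definition ternary (R : realType) (b : nat -> bool) : R :=
  limn (series (ternary_term R b)).

Lemma ternary_term_le (R : realType) (b : nat -> bool) (k : nat) :
  0 <= ternary_term R b k <= geometric (2 / 3) 3^-1 k.
Proof.
rewrite /ternary_term /geometric /= exprS invfM mulrA exprVn.
by case: (b k); rewrite lexx ?andbT divr_ge0// exprn_ge0.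
Qed.

Lemma cvg_ternary_bound (R : realType) :
  series (geometric (2 / 3) 3^-1 : R^nat) @ \oo --> (1 : R).
Proof.
have e : 2 / 3 / (1 - 3^-1) = 1 :> R by field.
rewrite -[X in _ --> X]e; apply: (@cvg_geometric_series R).
by rewrite gtr0_norm ?invr_gt0// invf_lt1// ltr1n.
Qed.

Lemma is_cvg_ternary (R : realType) (b : nat -> bool) :
  cvgn (series (ternary_term R b)).
Proof.
apply: (@series_le_cvg _ _ (geometric (2 / 3) 3^-1)) => [n|n|n|].
- by case/andP: (ternary_term_le R b n).
- by case/andP: (ternary_term_le R b n); exact: le_trans.
- by case/andP: (ternary_term_le R b n).
- exact/cvgP/cvg_ternary_bound.
Qed.

Lemma ternary_ge0_le1 (R : realType) (b : nat -> bool) : 0 <= ternary R b <= 1.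
Proof.
apply/andP; split.
  apply: limr_ge; first exact: is_cvg_ternary.
  apply: nearW => n; apply: sumr_ge0 => k _.
  by case/andP: (ternary_term_le R b k).
rewrite -(cvg_lim _ (@cvg_ternary_bound R))//.
apply: lim_series_le; first exact: is_cvg_ternary.
  exact/cvgP/cvg_ternary_bound.
by move=> k; case/andP: (ternary_term_le R b k).
Qed.

Lemma ternaryS (R : realType) (b : nat -> bool) :
  ternary R b = (2 * (b 0%N)%:R + ternary R (b \o S)) / 3.
Proof.
rewrite {1}/ternary; apply/cvg_lim => //; rewrite -cvg_shiftS /=.
have -> : (fun n => series (ternary_term R b) n.+1) =
    (fun n => (2 * (b 0%N)%:R + series (ternary_term R (b \o S)) n) / 3).
  apply/funext => n; rewrite /series/= big_nat_recl// mulrDl mulr_suml.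
  congr (_ + _).
    by rewrite /ternary_term expr1; case: (b 0%N); rewrite ?mulr1 ?mulr0 ?mul0r.
  apply: eq_bigr => k _; rewrite /ternary_term /=; case: (b k.+1); rewrite ?mul0r//.
  by rewrite [in LHS]exprSr invfM mulrA.
apply: cvgMl; apply: cvgD; [exact: cvg_cst|exact: is_cvg_ternary].
Qed.

(** Inverts the recursion of [ternaryS]: each step drops the leading digit, detected by comparison
    with 1/2. *)
Fixpoint unshift (R : realType) (r : R) (k : nat) : R :=
  if k is j.+1 then 3 * unshift r j - 2 * (2^-1 <= unshift r j)%R%:R else r.

Definition ternary_digit (R : realType) (r : R) (k : nat) : bool :=
  2^-1 <= unshift r k.

(** The tail lies in [0, 1], so the value lies in [0, 1/3] or in [2/3, 1] according to the first
    bit, and 1/2 separates the two. *)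
Lemma ternary_head (R : realType) (b : nat -> bool) :
  (2^-1 <= ternary R b) = b 0%N.
Proof.
rewrite [ternary R b]ternaryS; have := ternary_ge0_le1 R (b \o S).
move: (ternary R _) => e /andP[e0 e1].
by case: (b 0%N) => /=; [apply/idP|apply/negbTE; rewrite -ltNge]; lra.
Qed.

Lemma unshift_ternary (R : realType) (b : nat -> bool) (k : nat) :
  unshift (ternary R b) k = ternary R (fun i => b (k + i)%N).
Proof.
elim: k => [//|k IH] /=; rewrite IH ternary_head [in LHS]ternaryS addn0.
have -> : (fun i => b (k + i)%N) \o S = (fun i => b (k.+1 + i)%N).
  by apply/funext => i /=; rewrite addnS addSn.
by field.
Qed.

Lemma ternaryK (R : realType) (b : nat -> bool) (k : nat) :
  ternary_digit (ternary R b) k = b k.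
Proof. by rewrite /ternary_digit unshift_ternary ternary_head addn0. Qed.

Lemma measurable_ternary d (T : measurableType d) (R : realType)
    (b : T -> nat -> bool) :
  (forall k, measurable_fun setT (b ^~ k)) ->
  measurable_fun setT (fun x => ternary R (b x)).
Proof.
move=> mb; apply: (measurable_fun_cvg (h := fun n x => series (ternary_term R (b x)) n)).
  move=> n; apply: measurable_sum => k.
  by apply: measurable_fun_ifT => //; exact: mb.
by move=> x _; exact: is_cvg_ternary.
Qed.

Lemma measurable_ternary_digit (R : realType) (k : nat) :
  measurable_fun setT (fun r : R => ternary_digit r k).
Proof.
have mu : measurable_fun setT (fun r : R => unshift r k).
  elim: k => [|k IH] /=; first exact: measurable_id.
  apply: measurable_funB; first exact: measurable_funM.
  apply: measurable_funM => //.
  have -> : (fun r : R => (2^-1 <= unshift r k)%R%:R) =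
      (fun r : R => if 2^-1 <= unshift r k then 1 else 0 : R).
    by apply/funext => r; case: ifP.
  by apply: measurable_fun_ifT => //; exact: measurable_fun_ler.
exact: measurable_fun_ler.
Qed.

(** * Reals as suprema of sets of rationals *)

(* The Dedekind cut [c] may be empty or everything, hence the value in [\bar R]. *)
Definition cut (R : realType) (c : rat -> bool) : \bar R :=
  ereal_sup [set (ratr q)%:E | q in [set q | c q]].

Lemma cut_gtP (R : realType) (c : rat -> bool) (x : \bar R) :
  reflect (exists2 q, c q & (x < (ratr q)%:E)%E) (x < cut R c)%E.
Proof.
apply: (iffP ereal_sup_gtP) => [[_ [q cq <-] xq]|[q cq xq]]; first by exists q.
by exists (ratr q)%:E => //; exists q.
Qed.

Lemma cut_ratr_lt (R : realType) (x : R) : cut R (fun q => ratr q < x) = x%:E.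
Proof.
apply/eqP; rewrite eq_le; apply/andP; split.
  by apply: ge_ereal_sup => _ [q qx <-]; rewrite lee_fin ltW.
rewrite leNgt; apply/negP => lt_cut.
(* Once the cut is known to be finite, a rational fits between it and [x]; that rational belongs to
   the cut yet exceeds its supremum. *)
have cut_fin : cut R (fun q => ratr q < x) \is a fin_num.
  rewrite fin_numElt (lt_trans lt_cut) ?ltry// andbT.
  have /rat_in_itvoo[q] : x - 1 < x by lra.
  rewrite in_itv /= => /andP[_ qx].
  by apply/cut_gtP; exists q => //; rewrite ltNyr.
move: lt_cut; rewrite -(fineK cut_fin) lte_fin => /rat_in_itvoo[q].
rewrite in_itv /= => /andP[cq qx].
suff : (cut R (fun q => (ratr q < x)%R) < cut R (fun q => (ratr q < x)%R))%E.
  by rewrite ltxx.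
by apply/cut_gtP; exists q => //; rewrite -[ltLHS](fineK cut_fin) lte_fin.
Qed.

(** By [cut_gtP], the preimage of an open upper ray is a union over the countably many rationals. *)
Lemma measurable_cut d (T : measurableType d) (R : realType)
    (c : T -> rat -> bool) :
  (forall q, measurable_fun setT (c ^~ q)) ->
  measurable_fun setT (fun x => cut R (c x)).
Proof.
move=> mc; apply: (measurability _ (ErealGenOInfty.measurableE R)).
move=> _ [_ [a ->] <-]; rewrite setTI.
have -> : (fun x => cut R (c x)) @^-1` `]a%:E, +oo[ =
    \bigcup_q (if (a%:E < (ratr q)%:E)%E then (c ^~ q) @^-1` [set true] else set0).
  apply/seteqP; split => x /=.
    rewrite in_itv /= andbT => /cut_gtP[q cq aq].
    by exists q => //; rewrite aq.
  move=> [q _]; case: ifP => // aq /= cq; rewrite in_itv /= andbT.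
  by apply/cut_gtP; exists q.
apply: bigcupT_measurable_rat => q; case: ifP => // _.
by rewrite -[X in measurable X]setTI; exact: mc.
Qed.

(** * Measurable coding of R^n by one real *)

Definition encode (R : realType) (I : countType) (b : I -> bool) : R :=
  ternary R (fun k => if unpickle k is Some i then b i else false).

Definition bit (R : realType) (I : countType) (r : R) (i : I) : bool :=
  ternary_digit r (pickle i).

Lemma encodeK (R : realType) (I : countType) (b : I -> bool) :
  bit (encode R b) =1 b.
Proof. by move=> i; rewrite /bit ternaryK pickleK. Qed.

Definition tuple_code (R : realType) (n : nat) (x : n.-tuple R) : R :=
  encode R (fun iq : 'I_n * rat => ratr iq.2 < tnth x iq.1).

(** A real that codes no tuple may yield an infinite cut; [fine] makes the decoder total. *)
Definition tuple_decode (R : realType) (n : nat) (r : R) : n.-tuple R :=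
  [tuple fine (cut R (fun q => bit r (i, q))) | i < n].

Lemma tuple_codeK (R : realType) (n : nat) :
  cancel (@tuple_code R n) (@tuple_decode R n).
Proof.
move=> x; apply: eq_from_tnth => i; rewrite tnth_mktuple.
under eq_fun do rewrite encodeK /=.
by rewrite cut_ratr_lt.
Qed.

Lemma measurable_tuple_code (R : realType) (n : nat) :
  measurable_fun setT (@tuple_code R n).
Proof.
apply: measurable_ternary => k; case: unpickle => [[i q]|]; last exact: measurable_cst.
by apply: measurable_fun_ltr => //; exact: measurable_tnth.
Qed.

Lemma measurable_tuple_decode (R : realType) (n : nat) :
  measurable_fun setT (@tuple_decode R n).
Proof.
apply/measurable_fun_tnthP => i.
have -> : (@tnth n R)^~ i \o @tuple_decode R n =
    fine \o (fun r => cut R (fun q => bit r (i, q))).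
  by apply/funext => r /=; rewrite tnth_mktuple.
apply: measurableT_comp; first exact: fine_measurable.
by apply: measurable_cut => q; exact: measurable_ternary_digit.
Qed.

HB.instance Definition _ (R : realType) (n : nat) :=
  isMeasurableFun.Build _ _ _ _ (@tuple_code R n) (@measurable_tuple_code R n).

(** * The uniform law on [0, 1] *)

Definition uniform01 (R : realType) : probability (measurableTypeR R) R :=
  uniform_prob (@ltr01 R).

Lemma uniform01E (R : realType) (A : set (measurableTypeR R)) : measurable A ->
  uniform01 R A = lebesgue_measure (A `&` `[0, 1]%classic).
Proof.
move=> mA; rewrite [LHS]integral_uniform_pdf (eq_integral (cst 1%E)).
  by rewrite integral_cst//= ?mul1e//; exact: measurableI.
move=> x; rewrite inE => -[_]; rewrite /= in_itv /= /uniform_pdf => ->.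
by rewrite subr0 invr1.
Qed.

Lemma uniform01_itvoy (R : realType) (c : R) :
  0 <= c <= 1 -> uniform01 R `]c, +oo[%classic = (1 - c%:E)%E.
Proof.
move=> /andP[c0 c1]; rewrite uniform01E//.
have -> : `]c, +oo[%classic `&` `[0, 1] = `]c, 1]%classic :> set R.
  apply/seteqP; split => x /=; rewrite !in_itv /= ?andbT.
    by move=> [-> /andP[_ ->]].
  by move=> /andP[cx x1]; rewrite cx x1 (le_trans c0) ?ltW.
rewrite lebesgue_measure_itv /= lte_fin.
(* At [c = 1] the interval is empty and both sides are 0. *)
by case: ltgtP c1 => // -> _; rewrite subee.
Qed.

(** Allows the endpoints to be discarded, where the quantile function may take a junk value. *)
Lemma uniform01_itvoo (R : realType) : uniform01 R `]0, 1[%classic = 1%E.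
Proof.
rewrite uniform01E//.
have -> : `]0, 1[%classic `&` `[0, 1] = `]0, 1[%classic :> set R.
  by apply: setIidl => x /=; rewrite !in_itv /= => /andP[/ltW -> /ltW ->].
by rewrite lebesgue_measure_itv /= lte_fin ltr01 sube0.
Qed.

Lemma probability_setI1 d (T : measurableType d) (R : realType)
    (P : probability T R) (A D : set T) :
  measurable A -> measurable D -> P D = 1%E -> P (A `&` D) = P A.
Proof.
move=> mA mD PD; rewrite [RHS](measureDI P mA mD) [X in (X + _)%E](_ : _ = 0%E) ?add0e//.
apply: (@subset_measure0 _ _ _ P _ (~` D)).
- exact: measurableD.
- exact: measurableC.
- by move=> x [].
- by rewrite -[LHS]/(P (~` D)) probability_setC// PD subee.
Qed.

(** * Quantile functions from rational data *)

(* Only meaningful for [u] in ]0, 1[: elsewhere the cut may be infinite, and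
   [fine] then returns the junk value 0. *)
Definition quantile (R : realType) (F : rat -> \bar R) (u : R) : R :=
  fine (cut R (fun q => F q < u%:E)%E).

Lemma measurable_quantile (R : realType) (F : rat -> \bar R) :
  measurable_fun setT (quantile F).
Proof.
apply: measurableT_comp; first exact: fine_measurable.
by apply: measurable_cut => q; exact: measurable_fun_lte.
Qed.

Section quantile_law.
Context d (T : measurableType d) (R : realType) (P : probability T R).
Variable X : {RV P >-> R}.

Let F (q : rat) : \bar R := cdf X (ratr q).

(* Right continuity of the distribution function is what makes rational
   cuts sufficient. *)
Lemma cdf_lt_ratr (t u : R) :
  (cdf X t < u%:E)%E <-> exists2 q : rat, (F q < u%:E)%E & t < ratr q.
Proof.
split=> [Ftu|[q Fqu tq]]; last first.
  by apply: le_lt_trans Fqu; apply: cdf_nondecreasing; exact: ltW.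
have rc := @cdf_right_continuous _ _ _ _ X t.
have : \forall s \near t^'+, (cdf X s < u%:E)%E.
  apply: (rc [set y | (y < u%:E)%E]); apply: open_nbhs_nbhs; split => //.
  exact: open_ereal_lt_ereal.
move=> [e /= e0 he].
have /rat_in_itvoo[q] : t < t + e by rewrite ltrDl.
rewrite in_itv /= => /andP[tq qe]; exists q => //; apply: he => //=.
by rewrite ltr0_norm ?subr_lt0// opprB ltrBlDl.
Qed.

(** The limit 0 of the distribution function at -oo puts a rational in the cut, since [u > 0]; the
    limit 1 at +oo bounds the cut above, since [u < 1]. *)
Lemma cut_cdf_fin_num (u : R) : 0 < u < 1 ->
  cut R (fun q => F q < u%:E)%E \is a fin_num.
Proof.
move=> /andP[u0 u1]; rewrite fin_numElt; apply/andP; split.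
  have [s Fs] : exists s, (cdf X s < u%:E)%E.
    have := @cvg_cdfNy0 _ _ _ _ X.
    move=> /(_ [set y | (y < u%:E)%E]) [].
      by apply: open_nbhs_nbhs; split; [exact: open_ereal_lt_ereal|rewrite /= lte_fin].
    by move=> M [_ h]; exists (M - 1); apply: h; rewrite ltrBlDl ltrDr.
  by move/cdf_lt_ratr: Fs => [q Fq _]; apply/cut_gtP; exists q => //; exact: ltNyr.
have [s Fs] : exists s, (u%:E < cdf X s)%E.
  have := @cvg_cdfy1 _ _ _ _ X.
  move=> /(_ [set y | (u%:E < y)%E]) [].
    by apply: open_nbhs_nbhs; split; [exact: open_ereal_gt_ereal|rewrite /= lte_fin].
  by move=> M [_ h]; exists (M + 1); apply: h; rewrite ltrDl.
apply: le_lt_trans (ltry s); rewrite leNgt; apply/negP => /cut_gtP[q Fq].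
rewrite lte_fin => sq; have /cdf_lt_ratr : exists2 q : rat, (F q < u%:E)%E & s < ratr q.
  by exists q.
by rewrite ltNge ltW.
Qed.

(** Galois connection of quantile and distribution function: both sides amount to a rational [q]
    above [t] with [F q < u]. *)
Lemma quantile_gt (u t : R) : 0 < u < 1 ->
  (t < quantile F u) = (cdf X t < u%:E)%E.
Proof.
move=> u01; rewrite -lte_fin fineK ?cut_cdf_fin_num//.
apply/cut_gtP/idP => [[q Fq]|/cdf_lt_ratr[q Fq tq]].
  by rewrite lte_fin => tq; apply/cdf_lt_ratr; exists q.
by exists q.
Qed.

(** Inverse transform sampling: the rays []t, +oo[] are stable under intersection and generate the
    Borel sets, and both laws give such a ray mass [1 - cdf X t]. *)
Lemma uniform01_quantile (A : set R) : measurable A ->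
  uniform01 R (quantile F @^-1` A) = P (X @^-1` A).
Proof.
have mQ : (quantile F : measurableTypeR R -> R) \in mfun.
  by rewrite inE; exact: measurable_quantile.
pose Q : {RV uniform01 R >-> R} := mfun_Sub mQ.
rewrite -[RHS]/(distribution P X A) -[LHS]/(distribution (uniform01 R) Q A).
apply: (measure_unique (@RGenOInfty.G R) (fun k => `]- k%:R, +oo[%classic)).
- exact: RGenOInfty.measurableE.
- move=> _ _ [a ->] [b ->]; exists (Num.max a b).
  by apply/seteqP; split => x /=; rewrite !in_itv /= !andbT gt_max => /andP.
- by move=> k; exists (- k%:R).
- rewrite -subTset => x _; exists (Num.bound `|x|) => //=.
  by rewrite in_itv /= andbT ltrNl (le_lt_trans (ler_norm _))// normrN archi_boundP.
- move=> _ [t ->].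
  have Ft : cdf X t \is a fin_num by rewrite fin_num_measure.
  transitivity (1 - cdf X t)%E; last first.
    by rewrite -probability_setC// setCitvl.
  have Ft01 : 0 <= fine (cdf X t) <= 1.
    by rewrite fine_ge0// -lee_fin fineK// cdf_le1.
  rewrite -(fineK Ft) -(uniform01_itvoy Ft01).
  (* Both events are cut down to []0, 1[], where [quantile_gt] applies. *)
  have m01 : measurable (`]0, 1[%classic : set (measurableTypeR R)) by [].
  rewrite -[RHS](probability_setI1 _ m01 (uniform01_itvoo R))//.
  rewrite -[LHS](probability_setI1 _ m01 (uniform01_itvoo R)); last first.
    by rewrite -[X in measurable X]setTI; exact: (measurable_quantile F).
  congr (uniform01 R _); apply/seteqP; split => u /=; rewrite !in_itv/= ?andbT.
    by move=> [tu u01]; split => //; rewrite -lte_fin fineK// -quantile_gt.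
  by move=> [tu u01]; split => //; rewrite quantile_gt// -[ltLHS]fineK// lte_fin.
- by move=> k; rewrite (le_lt_trans (probability_le1 _ _)) ?ltry.
Qed.

End quantile_law.

(** * Sampling any law on R^n from a uniform variable and one real *)

(* [cut R (fun a => bit t (a, q))] is the value at [q] of the distribution
   function coded by [t]. *)
Definition sampler (R : realType) (n : nat) (t u : R) : n.-tuple R :=
  tuple_decode n (quantile (fun q => cut R (fun a => bit t (a, q))) u).

Lemma measurable_sampler (R : realType) (n : nat) (t : R) :
  measurable_fun setT (@sampler R n t).
Proof.
apply: measurableT_comp; [exact: measurable_tuple_decode|exact: measurable_quantile].
Qed.

Lemma sampler_law (R : realType) (n : nat) (P : probability (n.-tuple R) R) :
  exists t : R, forall A : set (n.-tuple R), measurable A ->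
    uniform01 R (sampler n t @^-1` A) = P A.
Proof.
pose X : {RV P >-> R} := @tuple_code R n.
pose F (q : rat) := cdf X (ratr q).
(* Bit [(a, q)] records [a < F q], so that the bits at fixed [q] form the lower cut of [F q]. *)
exists (encode R (fun aq : rat * rat => ((ratr aq.1)%:E < F aq.2)%E)) => A mA.
have -> : sampler n (encode R (fun aq : rat * rat => ((ratr aq.1)%:E < F aq.2)%E)) =
    @tuple_decode R n \o quantile F.
  apply/funext => u; rewrite /sampler /=; congr (tuple_decode _ (quantile _ u)).
  apply/funext => q; under eq_fun do rewrite encodeK /=.
  have Fq : F q \is a fin_num by rewrite fin_num_measure.
  under eq_fun do rewrite -[in X in (_ < X)%E](fineK Fq) lte_fin.
  by rewrite cut_ratr_lt fineK.
rewrite comp_preimage uniform01_quantile; last first.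
  by rewrite -[X in measurable X]setTI; exact: measurable_tuple_decode.
(* Decoding inverts coding, so the pulled-back event is [A] itself. *)
by rewrite -comp_preimage; congr (P _); apply/seteqP; split => x /=; rewrite tuple_codeK.
Qed.

(** The code is injective and measurable, so points inherit measurability from R. *)
Lemma measurable_set1_tuple (R : realType) (n : nat) (x : n.-tuple R) :
  measurable [set x].
Proof.
have -> : [set x] = @tuple_code R n @^-1` [set tuple_code x].
  by apply/seteqP; split => y /=; [move=> ->|move/(can_inj (@tuple_codeK R n))].
by rewrite -[X in measurable X]setTI; exact: measurable_tuple_code.
Qed.

(** * One ENN for all BNNs over a base network *)

Section universal_enn.
Context (R : realType) (f : base_network R).
Variable theta0 : (bn_dim f).-tuple R.

(* An ENN must be measurable on the whole index space, but a sample may leave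
   the parameter space, outside which [bn_fun] need not be measurable. *)
Definition retract (theta : (bn_dim f).-tuple R) : (bn_dim f).-tuple R :=
  if theta \in bn_params f then theta else theta0.

Lemma measurable_bn_retract (x : bn_input f) :
  measurable_fun setT (fun theta => bn_fun f (retract theta) x).
Proof.
have -> : (fun theta => bn_fun f (retract theta) x) =
    (fun theta => if theta \in bn_params f then bn_fun f theta x else bn_fun f theta0 x).
  by apply/funext => theta; rewrite /retract; case: ifP.
have paramsE : (fun theta => theta \in bn_params f) @^-1` [set true] = bn_params f.
  by apply/seteqP; split => theta /=; [move/set_mem|exact: mem_set].
apply: measurable_fun_if => //.
- by apply: (measurable_fun_bool true); rewrite setTI paramsE; exact: bn_params_measurable.
- by rewrite setTI paramsE; exact: bn_fun_measurable.
Qed.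

(** Built from [f] and [theta0] alone; the real parameter codes the sampling law. *)
Definition universal_enn : enn R (bn_input f) (bn_out f) :=
  @ENN R (bn_input f) (bn_out f) 1 setT _ (measurableTypeR R) (uniform01 R)
    (fun t x u => bn_fun f (retract (sampler (bn_dim f) (tnth t ord0) u)) x)
    (fun t x _ => measurableT_comp (@measurable_bn_retract x)
       (@measurable_sampler R (bn_dim f) (tnth t ord0))).

Lemma universal_enn_wrt : enn_wrt f universal_enn.
Proof.
move=> theta ptheta; have [t ht] := sampler_law (\d_theta : probability _ R).
exists [tuple t] => //.
have mth := measurable_set1_tuple theta.
(* The exceptional null set: the indices at which a sample from the Dirac law misses [theta]. *)
exists (~` (sampler (bn_dim f) t @^-1` [set theta])); split.
- apply: measurableC; rewrite -[X in measurable X]setTI.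
  exact: measurable_sampler.
- have ht1 : uniform01 R (sampler (bn_dim f) t @^-1` [set theta]) = 1%E.
    transitivity (\d_theta [set theta] : \bar R); first exact: ht.
    by rewrite diracE mem_set.
  rewrite probability_setC; first by rewrite [X in (1 - X)%E]ht1 subee.
  by rewrite -[X in measurable X]setTI; exact: measurable_sampler.
- apply: subsetC => u /= su; apply/funext => x.
  by rewrite (tnth_nth t)/= su /retract mem_set.
Qed.

Lemma bnn_expressed_as_universal_enn (B : bnn f) :
  bnn_expressed_as_enn B universal_enn.
Proof.
(* The code [t] is chosen from [nu] alone, so it serves all input lists at once. *)
move=> nu tau xs _; have [t ht] := sampler_law (bnn_dist nu).
exists [tuple t] => // A mA.
pose g theta := map_tuple (bn_fun f (retract theta)) xs.
have mg : measurable_fun setT g.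
  apply/measurable_fun_tnthP => i.
  have -> : (@tnth _ _)^~ i \o g = (fun theta => bn_fun f (retract theta) (tnth xs i)).
    by apply/funext => theta /=; rewrite tnth_map.
  exact: measurable_bn_retract.
have mgA : measurable (g @^-1` A) by rewrite -[X in measurable X]setTI; exact: mg.
(* The parameter space has mass 1, and [retract] is the identity there. *)
transitivity (bnn_dist nu (g @^-1` A)).
  rewrite -(probability_setI1 mgA (bn_params_measurable f) (bnn_dist_params nu)).
  rewrite /bnn_law /pushforward /mrestr; congr (bnn_dist nu _).
  by apply/seteqP; split => theta /= [h ptheta]; split => //; move: h;
    rewrite /g /= /retract mem_set.
by rewrite -ht.
Qed.

End universal_enn.

(** * An ENN that no BNN over its base network expresses *)

Section counterexample.
Context (R : realType).

(** In dimension 0 the empty tuple is the only parameter. *)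
Definition zero_network : base_network R :=
  @BaseNetwork R unit 1 0 setT (ex_intro _ [tuple] I) measurableT
    (fun _ _ => [tuple 0]) (fun _ => @measurable_cst _ _ _ _ _ _).

Definition constant_enn : enn R unit 1 :=
  @ENN R unit 1 1 setT _ unit \d_tt (fun theta _ _ => theta)
    (fun _ _ _ => @measurable_cst _ _ _ _ _ _).

Lemma constant_enn_wrt : enn_wrt zero_network constant_enn.
Proof.
move=> theta _; exists [tuple 0] => //.
exists set0; split => //.
by move=> z h; exfalso; apply: h; apply/funext.
Qed.

Lemma constant_enn_not_bnn (B : bnn zero_network) :
  ~ enn_expressed_as_bnn (f := zero_network) constant_enn B.
Proof.
move=> /(_ [tuple 1] 1%N [tuple tt] I isT)[nu].
(* The event that the output is 1 has mass 0 under the BNN and mass 1 under the ENN at parameter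
   1. *)
pose A : set (1.-tuple (1.-tuple R)) := [set y | tnth (tnth y ord0) ord0 = 1].
have mA : measurable A.
  have m11 : measurable_fun setT (fun y : 1.-tuple (1.-tuple R) => tnth (tnth y ord0) ord0).
    by apply: (measurableT_comp (f := fun y => tnth y ord0)); exact: measurable_tnth.
  by rewrite -[A]setTI; exact: (m11 measurableT [set 1] (measurable_set1 1)).
move=> /(_ A mA); rewrite /bnn_law /enn_law /pushforward /mrestr.
rewrite [X in bnn_dist nu X](_ : _ = set0); last first.
  apply/seteqP; split => // theta [].
  rewrite /A /= tnth_map /= => /eqP; rewrite (tnth_nth 0) /= eq_sym.
  by rewrite (negbTE (oner_neq0 R)).
rewrite measure0 /= diracE mem_set; first by move=> /eqP; rewrite eqe eq_sym oner_eq0.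
by rewrite /A /= tnth_map (tnth_nth 0).
Qed.

End counterexample.

Theorem theorem3 (R : realType) :
  (forall (f : base_network R) (B : bnn f),
     exists2 E : enn R (bn_input f) (bn_out f),
       enn_wrt f E & bnn_expressed_as_enn B E) /\
  (exists (f : base_network R) (E : enn R (bn_input f) (bn_out f)),
     enn_wrt f E /\ ~ exists B : bnn f, enn_expressed_as_bnn E B).
Proof.
split=> [f B|].
  have [theta0 _] := bn_params_nonempty f.
  exists (universal_enn theta0); first exact: universal_enn_wrt.
  exact: bnn_expressed_as_universal_enn.
exists (zero_network R), (constant_enn R); split; first exact: constant_enn_wrt.
by move=> [B]; exact: constant_enn_not_bnn.
Qed.
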